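(* Let $p$ be a prime, let $\pi\in\Omega_p$ be any root of the equation $x^{p-1}-p=0$, and let $\mathbf{M}_p=\{x\in\Omega_p : |x|_p<1\}$. Then the function $\mathbf{M}_p\to\mathbf{M}_p$, $x\mapsto W_p(\pi x)$, is not an analytic element on $\mathbf{M}_p$.
   Context: $\Omega_p$ denotes the algebraically closed, topologically complete and spherically complete $p$-adic field, an extension of $\mathbb{Q}_p$ with absolute value $|\cdot|_p$ extending the $p$-adic absolute value, normalized by $|p|_p=p^{-1}$. The $p$-adic Lambert function is $$W_p(x)=\sum_{n=1}^\infty\frac{(-n)^{n-1}}{n!}x^n,$$ which converges for $x\in\Omega_p$ with $|x|_p<p^{-\frac1{p-1}}$. Since $|\pi|_p=p^{-\frac1{p-1}}$, the function $x\mapsto W_p(\pi x)$ is defined on $\mathbf{M}_p$. A function $f:\mathbf{M}_p\to\Omega_p$ is called an analytic element on $\mathbf{M}_p$ if it is a uniform limit on $\mathbf{M}_p$ of a sequence of rational functions in $\Omega_p(x)$ having no poles in $\mathbf{M}_p$. *)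

(* Defs.v *)
From HB Require Import structures.
From mathcomp Require Import all_boot all_order all_algebra.
From mathcomp Require Import all_classical all_reals all_analysis.

Set Implicit Arguments.
Unset Strict Implicit.
Unset Printing Implicit Defensive.

Import Order.TTheory GRing.Theory Num.Theory.

Local Open Scope classical_set_scope.
Local Open Scope ring_scope.

Record ultra_absval (R : realType) (K : fieldType) := UltraAbsval {
  absval :> K -> R ;
  absval_ge0 : forall x, 0 <= absval x ;
  absval_eq0 : forall x, absval x = 0 <-> x = 0 ;
  absvalM : forall x y, absval (x * y) = absval x * absval y ;
  absval_ultra : forall x y, absval (x + y) <= Num.max (absval x) (absval y)
}.

(* The field K with the metric v (x - y), hence its topology and uniform
   structure.  The norm of normedZmodType is not available for v, because it
   satisfies `|x *+ n| = `|x| *+ n, which an ultrametric absolute value violates. *)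
Definition valued (R : realType) (K : fieldType) (v : ultra_absval R K) : Type :=
  K.

Section Metric.
Context {R : realType} {K : fieldType} (v : ultra_absval R K).
Implicit Types x y z : K.

Let absval1 : v 1 = 1.
Proof.
have v1 : v 1 != 0 by apply/eqP => /absval_eq0/eqP; rewrite oner_eq0.
by apply: (mulfI v1); rewrite -absvalM !mulr1.
Qed.

Let absvalN x : v (- x) = v x.
Proof.
suff vN1 : v (-1) = 1 by rewrite -mulN1r absvalM vN1 mul1r.
apply/eqP; rewrite -(@pexpr_eq1 _ _ 2) ?absval_ge0//.
by rewrite expr2 -absvalM mulrNN mulr1 absval1.
Qed.

Let absvalD x y : v (x + y) <= v x + v y.
Proof.
apply: le_trans (absval_ultra v x y) _.
by rewrite ge_max lerDl lerDr !absval_ge0.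
Qed.

Let dist_refl x : v (x - x) = 0.
Proof. by rewrite subrr; exact/absval_eq0. Qed.

Let dist_eq0 x y : v (x - y) = 0 -> x = y.
Proof. by move=> /absval_eq0/subr0_eq. Qed.

Let dist_sym x y : v (x - y) = v (y - x).
Proof. by rewrite -opprB absvalN. Qed.

Let dist_triangle y x z : v (x - z) <= v (x - y) + v (y - z).
Proof. by rewrite -(subrKA y x) absvalD. Qed.

HB.instance Definition _ := GRing.Field.on (valued v).
HB.instance Definition _ := isPointed.Build (valued v) (0 : K).
HB.instance Definition _ :=
  isMetric.Build R (valued v) dist_refl dist_eq0 dist_sym dist_triangle.

End Metric.

(* The p-adic absolute value |a/b|_p = p ^ (v_p(b) - v_p(a)) on the rationals;
   0 is treated apart because logn p 0 = 0. *)
Definition padic_abs (R : realType) (p : nat) (q : rat) : R :=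
  if q == 0 then 0
  else p%:R ^ ((logn p `|denq q|%N)%:Z - (logn p `|numq q|%N)%:Z).

Definition complete (R : realType) (K : fieldType) (v : ultra_absval R K) :=
  forall F : set_system (valued v), ProperFilter F -> cauchy F -> cvg F.

Definition spherically_complete (R : realType) (K : fieldType)
    (v : ultra_absval R K) :=
  forall (c : nat -> K) (r : nat -> R),
    (forall n, 0 < r n) ->
    (forall n, closed_ball_ v (c n.+1) (r n.+1) `<=` closed_ball_ v (c n) (r n)) ->
    \bigcap_n closed_ball_ v (c n) (r n) !=set0.

(* (K, v) is an algebraically closed, complete and spherically complete valued
   extension of Q_p: as v extends the p-adic absolute value of the rationals and
   K is complete, the closure of the rationals in K is a copy of Q_p with its
   absolute value. *)
Record is_Omega (R : realType) (p : nat) (K : closedFieldType)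
    (v : ultra_absval R K) : Prop := IsOmega {
  Omega_extends : forall q : rat, v (ratr q) = padic_abs R p q ;
  Omega_complete : complete v ;
  Omega_spherical : spherically_complete v
}.

Section AnalyticElements.
Context {R : realType} {K : fieldType} (v : ultra_absval R K).

Definition Mp : set (valued v) := [set x | v x < 1].

(* The sum of the series where it converges, an unspecified value elsewhere. *)
Definition lambertW (x : valued v) : valued v :=
  limn (fun N => \sum_(1 <= n < N) ((- n%:R) ^+ n.-1 / (n`!)%:R * x ^+ n)).

(* The pair (P, Q) stands for the rational function P / Q in lowest terms, whose
   poles are the roots of Q. *)
Definition ratfun_no_pole_in (D : set (valued v)) (h : {poly K} * {poly K}) :=
  [/\ h.2 != 0, coprimep h.1 h.2 & forall x, D x -> ~~ root h.2 x].

Definition ratfun_eval (h : {poly K} * {poly K}) (x : valued v) : valued v :=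
  h.1.[x] / h.2.[x].

(* Only the values of f on D matter. *)
Definition analytic_element (D : set (valued v)) (f : valued v -> valued v) :=
  exists h : nat -> {poly K} * {poly K},
    (forall n, ratfun_no_pole_in D (h n)) /\
    {uniform D, (fun n => ratfun_eval (h n)) @ \oo --> f}.

End AnalyticElements.

Arguments Mp {R K} v.

(* Main.v *)
Require Import Defs.
From HB Require Import structures.
From mathcomp Require Import all_boot all_order all_algebra.
From mathcomp Require Import cyclic separable cyclotomic.
From mathcomp Require Import all_classical all_reals all_analysis.

Set Implicit Arguments.
Unset Strict Implicit.
Unset Printing Implicit Defensive.

Import Order.TTheory GRing.Theory Num.Theory.

Local Open Scope classical_set_scope.
Local Open Scope ring_scope.

(** Write [v] for the absolute value and [w] for the root of [x ^ (p - 1) = p]. An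
    analytic element on the open unit disc is, up to any prescribed error, a
    quotient P / Q where Q has no root in the disc. After normalization, Q has
    constant coefficient 1 and integral coefficients ([integral_of_no_root]).
    Hence, if f is such an element and e the error, then [Q f - P] is bounded by
    e on the disc, and Cauchy's estimate bounds all its coefficients by e: beyond
    the degree of P, the coefficients of f satisfy, up to e, the linear recurrence
    with characteristic polynomial Q.

    The coefficients [a_n] of the Lambert series at [w x] violate every such
    recurrence. By Legendre's formula, [v (w ^ n / n!)] is [v w] to the power the
    sum of the base-p digits of n. For [n = p ^ k + 1] this gives
    [v a_n = v w ^ 2] ([lambert_coef_expS]), whereas the coefficients at
    [p ^ k, p ^ k - 1, p ^ k - 2, ...] have values tending to 0 with k
    ([lambert_coef_small]): at [p ^ k] because of the factor [n ^ (n - 1)], and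
    before it because the number of digits that are not 0 grows. So a recurrence
    of fixed length leaves a defect of value [v w ^ 2] at [p ^ k + 1]
    ([lambert_poly_mul_coef]), which contradicts an approximation within
    [v w ^ 3].

    The argument is carried out on polynomials, by truncating the series where its
    tail is below the error ([lambertW_approx]). Cauchy's estimate
    ([cauchy_estimate]) is then a finite Fourier inversion over roots of unity. *)

(** * Ultrametric absolute values and integral polynomials *)

Section UltrametricAbsoluteValue.
Context {R : realType} {K : fieldType} (v : ultra_absval R K).
Implicit Types (x y : K) (q : {poly K}).

Lemma absval0 : v 0 = 0.
Proof. by apply/(absval_eq0 v). Qed.

Lemma absval_gt0 x : (0 < v x) = (x != 0).
Proof.
rewrite lt0r absval_ge0 andbT; congr (~~ _).
by apply/eqP/eqP => [/absval_eq0|->]//; exact: absval0.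
Qed.

Lemma absval1 : v 1 = 1.
Proof.
have v1 : v 1 != 0 by rewrite gt_eqF// absval_gt0 oner_eq0.
by apply: (mulfI v1); rewrite -absvalM !mulr1.
Qed.

Lemma absvalX x n : v (x ^+ n) = v x ^+ n.
Proof. by elim: n => [|n IH]; rewrite ?absval1// !exprS absvalM IH. Qed.

Lemma absval_unity x n : (0 < n)%N -> x ^+ n = 1 -> v x = 1.
Proof.
move=> n0 xn; apply/eqP; rewrite -(@pexpr_eq1 _ _ n) ?absval_ge0//.
by rewrite -absvalX xn absval1.
Qed.

Lemma absvalN x : v (- x) = v x.
Proof.
rewrite -mulN1r absvalM (@absval_unity _ 2) ?mul1r//.
by rewrite expr2 mulrNN mulr1.
Qed.

Lemma absvalV x : v x^-1 = (v x)^-1.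
Proof.
have [->|x0] := eqVneq x 0; first by rewrite invr0 absval0 invr0.
have vx : v x != 0 by rewrite gt_eqF// absval_gt0.
by apply: (mulfI vx); rewrite -absvalM !mulfV// absval1.
Qed.

Lemma absvalD_le x y e : v x <= e -> v y <= e -> v (x + y) <= e.
Proof. by move=> xe ye; rewrite (le_trans (absval_ultra _ _ _))// ge_max xe. Qed.

Lemma absvalB_le x y e : v x <= e -> v y <= e -> v (x - y) <= e.
Proof. by move=> xe ye; apply: absvalD_le; rewrite ?absvalN. Qed.

Lemma absval_sum_le (I : Type) (r : seq I) (P : pred I) (F : I -> K) e :
  0 <= e -> (forall i, P i -> v (F i) <= e) -> v (\sum_(i <- r | P i) F i) <= e.
Proof.
move=> e0 Fe; apply: (big_ind (fun x => v x <= e)) => //.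
  by rewrite absval0.
by move=> x y; exact: absvalD_le.
Qed.

Lemma absval_nat_le1 n : v n%:R <= 1.
Proof.
elim: n => [|n IH]; first by rewrite absval0.
by rewrite -natr1; apply: absvalD_le; rewrite ?absval1.
Qed.

(** If this natural number had value less than 1, so would its difference with a
    multiple of p, which is 1. Such numbers provide arbitrarily large integers
    that are units of the valuation ring. *)
Lemma absval_nat_mod1 p m : v p%:R < 1 -> v (m * p).+1%:R = 1.
Proof.
move=> p1; apply/eqP; rewrite eq_le absval_nat_le1 leNgt; apply/negP => lt1.
suff: v 1 < 1 by rewrite absval1 ltxx.
rewrite -[X in v X](addrK ((m * p)%:R : K)) nat1r.
apply: le_lt_trans (absval_ultra _ _ _) _; rewrite gt_max lt1 absvalN natrM absvalM.
by apply: le_lt_trans p1; rewrite ler_piMl ?absval_ge0 ?absval_nat_le1.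
Qed.

Lemma absval_horner_le1 q x :
  (forall i, v q`_i <= 1) -> v x <= 1 -> v q.[x] <= 1.
Proof.
move=> q1 x1; rewrite horner_coef; apply: absval_sum_le => // i _.
by rewrite absvalM absvalX mulr_ile1 ?exprn_ge0 ?absval_ge0 ?exprn_ile1 ?absval_ge0.
Qed.

(** Each factor is [- z] times [1 - X / z], and multiplying by [1 - X / z] keeps
    the constant coefficient and, as [v z >= 1], the integrality. *)
Lemma integral_prod_XsubC (s : seq K) : (forall z, z \in s -> 1 <= v z) ->
  exists2 q : {poly K}, q`_0 = 1 /\ (forall i, v q`_i <= 1)
    & \prod_(z <- s) ('X - z%:P) = (\prod_(z <- s) - z) *: q.
Proof.
elim: s => [|z s IH] zs.
  exists 1; rewrite ?big_nil ?scale1r//; split=> [|i]; rewrite coef1//.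
  by case: (i == 0)%N; rewrite ?absval0 ?absval1.
have [|q [q0 q1] qE] := IH; first by move=> t ts; rewrite zs// in_cons ts orbT.
have z1 : 1 <= v z by rewrite zs// mem_head.
have z0 : z != 0 by rewrite -absval_gt0 (lt_le_trans ltr01).
exists (q - z^-1 *: ('X * q)).
  split=> [|i]; rewrite coefB coefZ coefXM; first by rewrite /= mulr0 subr0.
  apply: absvalB_le => //; rewrite absvalM absvalV.
  rewrite mulr_ile1 ?invr_ge0 ?absval_ge0 ?invf_le1 ?(lt_le_trans ltr01)//.
  by case: (i == 0)%N; rewrite ?absval0.
rewrite !big_cons qE mulrC -scalerAl.
rewrite [- z * _]mulrC -[RHS]scalerA; congr (_ *: _).
rewrite mulrC mulrBl mul_polyC scalerBr scalerA mulNr divff// scaleN1r opprK.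
by rewrite scaleNr addrC.
Qed.

End UltrametricAbsoluteValue.

(** * Cauchy's estimate *)

Section ClosedUltrametricField.
Context {R : realType} {K : closedFieldType} (v : ultra_absval R K).
Implicit Types (x y : K) (q : {poly K}).

(** The denominators of the approximating rational functions enter the argument
    through this normalization: it turns the absence of poles in the open unit
    disc into an integral linear recurrence with invertible leading term. *)
Lemma integral_of_no_root q : (forall x, v x < 1 -> ~~ root q x) ->
  exists a, exists2 u : {poly K},
    u`_0 = 1 /\ (forall i, v u`_i <= 1) & q = a *: u.
Proof.
move=> nr; have [s qE] := closed_field_poly_normal q.
have [|u u1 uE] := integral_prod_XsubC (v := v) (s := s).
  move=> z zs; rewrite leNgt; apply/negP => /nr /negP; apply.
  rewrite qE rootE hornerZ horner_prod (big_rem z)//= hornerXsubC subrr.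
  by rewrite mul0r mulr0.
by exists (lead_coef q * \prod_(z <- s) - z), u; rewrite // -scalerA -uE.
Qed.

Lemma closed_prim_root_exists m : m%:R != 0 :> K ->
  exists z : K, m.-primitive_root z.
Proof.
move=> m0; have mgt0 : (0 < m)%N by case: m m0 => //; rewrite eqxx.
have [s sE] := closed_field_poly_normal ('X^m - 1 : {poly K}).
rewrite lead_coefXnsubC// scale1r in sE.
have : has m.-primitive_root s.
  apply: has_prim_root => //.
  - apply/allP => z zs; rewrite /root_of_unity sE rootE horner_prod.
    by rewrite (big_rem z)//= hornerXsubC subrr mul0r.
  - by rewrite -separable_prod_XsubC -sE separable_Xn_sub_1.
  - by rewrite -ltnS -(size_prod_XsubC s id) -sE size_XnsubC.
by move=> /hasP[z _ zm]; exists z.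
Qed.

(** Fourier inversion on the circle: averaging [z ^- n * T.[z x]] over the m-th
    roots of unity z, with m larger than n and the degree of T,
    isolates the monomial of degree n. The average costs nothing in absolute
    value because m can be chosen to be a unit of the valuation ring. *)
Lemma cauchy_estimate (p : nat) (T : {poly K}) x e n :
  (0 < p)%N -> v p%:R < 1 -> 0 <= e ->
  (forall y, v y = v x -> v T.[y] <= e) -> v T`_n * v x ^+ n <= e.
Proof.
move=> p0 p1 e0 Te; set m := ((size T + n) * p).+1.
have sm : (size T + n < m)%N by rewrite ltnS leq_pmulr.
have vm : v m%:R = 1 by exact: absval_nat_mod1.
have m0 : m%:R != 0 :> K by rewrite -(absval_gt0 v) vm.
have [z zm] := closed_prim_root_exists m0.
have vz : v z = 1 := absval_unity v (ltn0Sn _) (prim_expr_order zm).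
have z0 : z != 0 by rewrite -(absval_gt0 v) vz.
have avg : \sum_(i < m) z ^- (i * n) * T.[z ^+ i * x] = m%:R * (T`_n * x ^+ n).
  transitivity (\sum_(j < m)
      (T`_j * x ^+ j) * \sum_(i < m) (z ^+ j / z ^+ n) ^+ i).
    transitivity (\sum_(i < m) \sum_(j < m)
        (T`_j * x ^+ j) * (z ^+ j / z ^+ n) ^+ i).
      apply: eq_bigr => i _; rewrite (@horner_coef_wide _ m); last first.
        by rewrite ltnW// (leq_ltn_trans _ sm)// leq_addr.
      rewrite big_distrr; apply: eq_bigr => j _ /=.
      rewrite exprMn exprMn exprVn -!exprM (mulnC i n) (mulnC i j).
      rewrite mulrCA -[RHS]mulrA; congr (_ * _).
      by rewrite mulrC -mulrA [RHS]mulrCA.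
    by rewrite exchange_big; apply: eq_bigr => j _; rewrite big_distrr.
  have nm : (n < m)%N by rewrite (leq_ltn_trans _ sm)// leq_addl.
  rewrite (bigD1 (Ordinal nm))//= [X in _ + X]big1 ?addr0 => [|j jn].
    rewrite mulfV ?expf_neq0// (eq_bigr (fun=> 1)) => [|i _].
      by rewrite sumr_const card_ord mulrC.
    by rewrite expr1n.
  (* A geometric sum whose ratio is an m-th root of unity other than 1. *)
  suff -> : \sum_(i < m) (z ^+ j / z ^+ n) ^+ i = 0 by rewrite mulr0.
  apply/eqP; have /eqP := subrX1 (z ^+ j / z ^+ n) m.
  rewrite exprMn exprVn -!exprM !(mulnC _ m) !exprM (prim_expr_order zm) !expr1n.
  rewrite invr1 mulr1 subrr eq_sym mulf_eq0 => /orP[|//].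
  rewrite subr_eq0 => /eqP zjn; case/negP: jn; rewrite -val_eqE/=.
  have : z ^+ j == z ^+ n by rewrite -[X in _ == X]mul1r -zjn divfK ?expf_neq0.
  by rewrite (eq_prim_root_expr zm) !modn_small.
rewrite -absvalX -absvalM -[leLHS]mul1r -vm -absvalM -avg.
apply: absval_sum_le => // i _.
rewrite absvalM absvalV absvalX vz expr1n invr1 mul1r Te//.
by rewrite absvalM absvalX vz expr1n mul1r.
Qed.

End ClosedUltrametricField.

(** * Limits in a complete ultrametric field *)

Section Complete.
Import numFieldNormedType.Exports.
Context {R : realType} {K : fieldType} (v : ultra_absval R K).

Lemma expr_small (r e : R) : 0 <= r < 1 -> 0 < e -> exists N, r ^+ N <= e.
Proof.
move=> /andP[r0 r1] e0.
have /cvgr0_norm_le/(_ _ e0) : (r ^+ N) @[N --> \oo] --> (0 : R).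
  by apply: cvg_expr; rewrite ger0_norm.
move=> [N _ /(_ N (leqnn N))] /=; rewrite ger0_norm ?exprn_ge0// => rN.
by exists N.
Qed.

(** The ultrametric inequality makes such a sequence Cauchy and passes the bound
    on differences to the limit without loss. *)
Lemma limn_approx (s : nat -> valued v) (r : R) : complete v -> 0 <= r < 1 ->
  (forall M N, (M <= N)%N -> v (s N - s M) <= r ^+ M) ->
  forall M, v (limn s - s M) <= r ^+ M.
Proof.
move=> cv r01 sr M.
have cs : cvgn s.
  apply: cv; apply: cauchy_exP => e e0.
  have [N rN] := expr_small r01 (divr_gt0 e0 (ltr0n _ 2)).
  exists (s N); exists N => // n /= Nn.
  rewrite /ball/= -absvalN opprB (le_lt_trans (sr _ _ Nn))//.
  by rewrite (le_lt_trans rN)// ltr_pdivrMr// ltr_pMr// ltr1n.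
apply/ler_addgt0Pr => e e0.
move/cvg_ballP : cs => /(_ _ e0)[N _ /(_ (maxn N M) (leq_maxl _ _))].
rewrite /ball/= => lN.
rewrite -(subrKA (s (maxn N M))); apply: absvalD_le.
  by rewrite (le_trans (ltW lN))// lerDr exprn_ge0//; case/andP: r01.
by rewrite (le_trans (sr _ _ (leq_maxr _ _)))// lerDl ltW.
Qed.

Lemma uniform_cvg_approx (D : set (valued v)) (h : nat -> valued v -> valued v)
    (f : valued v -> valued v) (e : R) :
  {uniform D, h @ \oo --> f} -> 0 < e ->
  exists n, forall x, D x -> v (f x - h n x) <= e.
Proof.
move=> hf e0.
have : nbhs (f : {uniform` D -> valued v})
    [set g | forall x, D x -> v (f x - g x) <= e].
  apply/uniform_nbhs; exists [set xy | ball xy.1 e xy.2].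
  split; first by rewrite -entourage_ballE; exists e.
  by move=> g /= gf x /gf /ltW.
by move=> /hf [N _ /(_ N (leqnn N))] hN; exists N.
Qed.

End Complete.

(** * Legendre's formula *)

(** The sum of the [n %/ p ^ k] telescopes once multiplied by [p - 1], because p
    times [n %/ p ^ k.+1] is at most [n %/ p ^ k]. *)
Lemma logn_fact_le p n : prime p -> (p.-1 * logn p n`! <= n)%N.
Proof.
move=> pp; rewrite logn_fact//.
suff H M : (p.-1 * (\sum_(1 <= k < M.+1) n %/ p ^ k) + n %/ p ^ M <= n)%N.
  by apply: leq_trans (H n); rewrite leq_addr.
elim: M => [|M IH]; first by rewrite big_geq// muln0 expn0 divn1.
rewrite big_nat_recr//= mulnDr -addnA -mulSnr prednK ?prime_gt0//.
by apply: leq_trans IH; rewrite leq_add2l expnSr divnMA mulnC leq_divM.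
Qed.

Lemma logn_fact_exp p k : prime p -> (p.-1 * logn p (p ^ k)`!)%N = (p ^ k).-1.
Proof.
move=> pp; rewrite logn_fact// (big_cat_nat (n := k.+1))//=; last first.
  by rewrite ltnS ltnW// ltn_expl// prime_gt1.
rewrite [X in (_ + X)%N]big_nat_cond [X in (_ + X)%N]big1 ?addn0; last first.
  by move=> i /andP[/andP[ki _] _]; rewrite divn_small// ltn_exp2l// prime_gt1.
rewrite predn_exp big_add1/= big_mkord (reindex_inj rev_ord_inj)/=.
congr (_ * _)%N; apply: eq_bigr => i _.
by rewrite subnSK// -expnB ?prime_gt0 ?leq_subr// subKn// ltnW.
Qed.

(** * Values of the coefficients of the Lambert series *)

Section PadicValues.
Context {R : realType} {p : nat} (p_prime : prime p).
Context {K : fieldType} (v : ultra_absval R K).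
Context (v_padic : forall q : rat, v (ratr q) = padic_abs R p q).

Lemma absval_nat n : (0 < n)%N -> v n%:R = p%:R ^- logn p n.
Proof.
move=> n0; have /= := v_padic n%:R; rewrite ratr_nat => ->.
rewrite /padic_abs pnatr_eq0 gtn_eqF// -[n%:R]/(n%:Z%:~R) numq_int denq_int.
by rewrite logn1 sub0r exprnN.
Qed.

Context (w : K) (w_root : w ^+ p.-1 = p%:R).

Lemma absval_root : v w ^+ p.-1 = p%:R^-1.
Proof.
rewrite -absvalX w_root absval_nat ?prime_gt0// -[X in logn p X]expn1.
by rewrite pfactorK// expr1.
Qed.

Lemma absval_root_itv : 0 < v w < 1.
Proof.
have p1 := prime_gt1 p_prime.
have rp := absval_root.
have p10 : (0 < p.-1)%N by rewrite -subn1 subn_gt0.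
have w0 : v w != 0.
  apply/eqP => w0; move: rp; rewrite w0 expr0n gtn_eqF//= => /esym/eqP.
  by rewrite invr_eq0 pnatr_eq0 gtn_eqF// ltnW.
rewrite lt0r w0 absval_ge0/= -(@expr_lt1 _ p.-1)// ?absval_ge0// rp.
by rewrite invf_lt1 ?ltr1n// ltr0n ltnW.
Qed.

Lemma absval_natE n : (0 < n)%N -> v n%:R = v w ^+ (p.-1 * logn p n).
Proof. by move=> n0; rewrite absval_nat// exprM absval_root exprVn. Qed.

(** These are the coefficients of the series of exp (w x), from which those of the
    Lambert series differ by powers of integers. *)
Definition exp_coef n : K := w ^+ n / n`!%:R.

Lemma absval_exp_coefE n : v (exp_coef n) = v w ^+ (n - p.-1 * logn p n`!).
Proof.
have /andP[w0 _] := absval_root_itv.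
rewrite /exp_coef absvalM absvalV absvalX absval_natE ?fact_gt0//.
by rewrite -{1}(subnK (logn_fact_le n p_prime)) exprD mulfK// expf_neq0// gt_eqF.
Qed.

Lemma absval_exp_coef_le1 n : v (exp_coef n) <= 1.
Proof.
have /andP[w0 w1] := absval_root_itv.
by rewrite absval_exp_coefE exprn_ile1// ltW.
Qed.

Lemma absval_exp_coef_exp k : v (exp_coef (p ^ k)) = v w.
Proof.
rewrite absval_exp_coefE logn_fact_exp// -subn1 subKn ?expr1//.
by rewrite expn_gt0 prime_gt0.
Qed.

Lemma absval_natp_lt1 : v p%:R < 1.
Proof.
have /andP[w0 w1] := absval_root_itv.
by rewrite -w_root absvalX expr_lt1 ?absval_ge0// -subn1 subn_gt0 prime_gt1.
Qed.

Lemma absval_exp_coefS n : v (exp_coef n.+1) * v n.+1%:R = v (exp_coef n) * v w.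
Proof.
have n0 : n.+1%:R != 0 :> K.
  have /andP[w0 _] := absval_root_itv.
  by rewrite -(absval_gt0 v) absval_natE// exprn_gt0.
rewrite -!absvalM /exp_coef factS natrM invfM exprS; congr (v _).
by rewrite [_^-1 * _]mulrC !mulrA divfK// -mulrA mulrC.
Qed.

Lemma absval_expn k : v (p ^ k)%:R <= v w ^+ k.
Proof.
have /andP[w0 w1] := absval_root_itv.
rewrite absval_natE ?expn_gt0 ?prime_gt0// pfactorK//.
by rewrite ler_wiXn2l ?ltW// leq_pmull// -subn1 subn_gt0 prime_gt1.
Qed.

(** Going down from index [p ^ k], the step to [p ^ k - 1] multiplies the value by
    [v (p ^ k)] over [v w], which is tiny, and each further step multiplies it by
    at most the inverse of [v w]. *)
Lemma absval_exp_coef_below k j : (j < p ^ k)%N ->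
  v (exp_coef (p ^ k - j.+1)) * v w ^+ j <= v w ^+ k.
Proof.
have /andP[w0 w1] := absval_root_itv.
move=> jk; apply: le_trans (absval_expn k); elim: j jk => [|j IH] jk.
  rewrite expr0 mulr1 -(ler_pM2r w0) -absval_exp_coefS subn1 prednK//.
  by rewrite absval_exp_coef_exp mulrC.
apply: le_trans (IH (ltnW jk)); rewrite exprS mulrA -absval_exp_coefS.
rewrite ler_wpM2r ?exprn_ge0 ?absval_ge0// subnSK//.
by rewrite ler_piMr ?absval_ge0// absval_nat_le1.
Qed.

(** The value at 0 is set apart because the generic formula gives 1 there while
    the series has no constant term. *)
Definition lambert_coef (n : nat) : K :=
  if n == 0%N then 0 else (- n%:R) ^+ n.-1 * exp_coef n.

Lemma absval_lambert_coef n : (0 < n)%N ->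
  v (lambert_coef n) = v n%:R ^+ n.-1 * v (exp_coef n).
Proof.
by rewrite /lambert_coef; case: n => // n _; rewrite absvalM absvalX absvalN.
Qed.

Lemma lambert_coef_le n : v (lambert_coef n) <= v (exp_coef n).
Proof.
case: n => [|n]; first by rewrite /lambert_coef absval0 absval_ge0.
rewrite absval_lambert_coef// ler_piMl ?absval_ge0//.
by rewrite exprn_ile1 ?absval_ge0// absval_nat_le1.
Qed.

(** The coefficients form long runs of small terms just before index [p ^ k + 1].
    At [p ^ k] itself the coefficient of the exponential series is not small,
    but the factor [(p ^ k) ^ (p ^ k - 1)] is. *)
Lemma lambert_coef_small k i : (0 < k)%N -> (i <= k)%N ->
  v (lambert_coef (p ^ k - i)) <= v w ^+ (k - i).
Proof.
have /andP[w0 w1] := absval_root_itv.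
move=> k0 ik; have kp : (k < p ^ k)%N by rewrite ltn_expl// prime_gt1.
have q1 : (1 < p ^ k)%N by apply: leq_trans kp; rewrite ltnS.
have iq : (i <= p ^ k)%N by apply: leq_trans ik (ltnW kp).
case: i ik iq => [|i] ik iq.
  rewrite !subn0 absval_lambert_coef ?(ltnW q1)// absval_exp_coef_exp.
  case: (p ^ k)%N q1 (absval_expn k) => [//|[//|q]] _ qk.
  rewrite /= exprS -mulrA; apply: le_trans qk.
  rewrite ler_piMr ?absval_ge0// mulr_ile1 ?exprn_ge0 ?absval_ge0//.
    by rewrite exprn_ile1 ?absval_ge0// absval_nat_le1.
  exact: ltW.
apply: le_trans (lambert_coef_le _) _.
rewrite -(ler_pM2r (exprn_gt0 i w0)); apply: le_trans (absval_exp_coef_below iq) _.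
by rewrite -exprD ler_wiXn2l ?ltW// -ltnS -addnS subnK.
Qed.

(** The run of small terms is broken here: [p ^ k + 1] is a unit of the valuation
    ring, so the value is the one at [p ^ k] of the exponential series, namely
    [v w], multiplied by [v w] once more. *)
Lemma lambert_coef_expS k : (0 < k)%N -> v (lambert_coef (p ^ k).+1) = v w ^+ 2.
Proof.
case: k => // k _; rewrite absval_lambert_coef//.
have q1 : v (p ^ k.+1).+1%:R = 1.
  by rewrite expnSr absval_nat_mod1// absval_natp_lt1.
have := absval_exp_coefS (p ^ k.+1); rewrite q1 mulr1 => ->.
by rewrite expr1n mul1r absval_exp_coef_exp expr2.
Qed.

Definition lambert_poly N : {poly K} := \poly_(i < N) lambert_coef i.

(** No recurrence with integral coefficients and leading coefficient 1 annihilates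
    the Lambert series, even approximately: the coefficient of [q * W] at
    [p ^ k + 1] is the corresponding coefficient of W, of value [v w ^+ 2], plus a
    combination of at most [size q] preceding ones, of value at most [v w ^+ 3]. *)
Lemma lambert_poly_mul_coef (q : {poly K}) k N :
  q`_0 = 1 -> (forall i, v q`_i <= 1) ->
  (size q + 3 <= k)%N -> ((p ^ k).+1 < N)%N ->
  v w ^+ 3 < v (q * lambert_poly N)`_(p ^ k).+1.
Proof.
have /andP[w0 w1] := absval_root_itv.
move=> q0 q1 qk kN; rewrite ltNge; apply/negP => small.
set n := (p ^ k).+1 in kN small.
have k0 : (0 < k)%N by rewrite (leq_trans _ qk)// addn_gt0 orbT.
have coefE : (q * lambert_poly N)`_n = lambert_coef n
    + \sum_(i < n) q`_i.+1 * lambert_coef (p ^ k - i).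
  rewrite coefM big_ord_recl/= q0 mul1r subn0 coef_poly kN; congr (_ + _).
  apply: eq_bigr => i _; rewrite /bump/= add1n subSS coef_poly.
  by rewrite (leq_ltn_trans (leq_subr _ _))// ltnW.
suff : v (lambert_coef n) <= v w ^+ 3.
  by rewrite lambert_coef_expS// ler_iXn2l.
rewrite -[lambert_coef n](addrK
  (\sum_(i < n) q`_i.+1 * lambert_coef (p ^ k - i))).
rewrite -coefE; apply: absvalB_le => //.
apply: absval_sum_le => [|i _]; first by rewrite exprn_ge0// ltW.
have [iq|qi] := ltnP i (size q); last first.
  by rewrite nth_default ?(leqW qi)// mul0r absval0 exprn_ge0// ltW.
have ik : (i + 3 <= k)%N by apply: leq_trans qk; rewrite leq_add2r ltnW.
have lik : (i <= k)%N by apply: leq_trans ik; rewrite leq_addr.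
rewrite absvalM -[leRHS]mul1r ler_pM ?absval_ge0//.
apply: le_trans (lambert_coef_small k0 lik) _.
by rewrite ler_wiXn2l ?ltW// leq_subRL.
Qed.

Lemma lambert_polyE N x : (lambert_poly N).[x] =
  \sum_(1 <= n < N) ((- n%:R) ^+ n.-1 / (n`!)%:R * (w * x) ^+ n).
Proof.
rewrite horner_poly -(big_mkord xpredT (fun i => lambert_coef i * x ^+ i)).
case: N => [|N]; first by rewrite !big_geq.
rewrite big_ltn//= mul0r add0r; apply: eq_big_nat => n /andP[n0 _].
rewrite /lambert_coef gtn_eqF// /exp_coef exprMn -!mulrA; congr (_ * _).
by rewrite mulrCA.
Qed.

(** The coefficients are integral, so the tail of the series from index N on is
    bounded by its first power of x. *)
Lemma lambertW_approx (x : valued v) N : complete v -> v x < 1 ->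
  v (lambertW (w * x : valued v) - (lambert_poly N).[x]) <= v x ^+ N.
Proof.
move=> cv x1.
rewrite /lambertW.
rewrite -[X in limn X](_ : (fun N => (lambert_poly N).[x] : valued v) = _).
  apply: (limn_approx (s := fun N => (lambert_poly N).[x])) => //.
    by rewrite absval_ge0.
  move=> M M' MM'; rewrite !horner_poly.
  rewrite -!(big_mkord xpredT (fun i => lambert_coef i * x ^+ i)).
  rewrite (big_cat_nat (n := M))//= addrAC subrr add0r big_nat.
  apply: absval_sum_le => [|i /andP[Mi _]]; first by rewrite exprn_ge0 ?absval_ge0.
  rewrite absvalM absvalX -[leRHS]mul1r ler_pM ?exprn_ge0 ?absval_ge0//.
    by rewrite (le_trans (lambert_coef_le i))// absval_exp_coef_le1.
  by rewrite ler_wiXn2l ?absval_ge0 ?ltW.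
by apply/funext => M; rewrite lambert_polyE.
Qed.

End PadicValues.

(** * The Lambert function is not an analytic element *)

Theorem theorem2 (R : realType) (p : nat) (p_prime : prime p)
    (K : closedFieldType) (v : ultra_absval R K) (K_Omega : is_Omega p v)
    (w : valued v) (w_root : w ^+ p.-1 - p%:R = 0) :
  (forall x : valued v, Mp v x -> Mp v (lambertW (w * x))) /\
  ~ analytic_element (Mp v) (fun x : valued v => lambertW (w * x)).
Proof.
have [vp cv _] := K_Omega.
have wE : (w : K) ^+ p.-1 = p%:R by apply/subr0_eq.
have /andP[w0 w1] := absval_root_itv p_prime vp wE.
have approx := lambertW_approx p_prime vp wE.
split=> [x x1|].
  have := approx x 1%N cv x1.
  rewrite /lambert_poly horner_poly big_ord1 mul0r subr0 expr1.
  by move=> /le_lt_trans; exact.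
move=> [h [h_nopole h_cvg]].
(* One of the four factors v w pays for Cauchy's estimate below; the remaining
   precision [v w ^+ 3] must separate the values [v w ^+ 2] and [v w ^+ 3]. *)
have [m hm] := uniform_cvg_approx h_cvg (exprn_gt0 4 w0).
have [Q0 _ nr] := h_nopole m.
have [a [q [q0 q1] QE]] := integral_of_no_root nr.
move: hm Q0 nr QE; rewrite /ratfun_eval; case: (h m) => P Q /= hm Q0 nr QE.
have a0 : a != 0 by apply: contraNneq Q0 => a0; rewrite QE a0 scale0r.
(* Since k exceeds the size of P, the polynomial P has no monomial of degree n. *)
set k := (size P + (size q + 3))%N.
set n := (p ^ k).+1.
(* On this circle the n-th power of the radius is v w whatever n is, so that the
   loss in Cauchy's estimate does not depend on n. *)
have [x xn] : exists x : K, x ^+ n = w.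
  have [x xE] := @solve_monicpoly K n (fun i => if i == 0%N then w else 0) isT.
  exists x; rewrite xE big_ord_recl/= mulr1 big1 ?addr0// => i _.
  by rewrite mul0r.
have rn : v x ^+ n = v w by rewrite -absvalX xn.
have r1 : v x < 1 by rewrite -(@expr_lt1 _ n) ?absval_ge0// rn.
have r01 : 0 <= v x < 1 by rewrite absval_ge0.
have [N0 rN0] := expr_small r01 (exprn_gt0 4 w0).
set N := maxn N0 n.+1.
have rN : v x ^+ N <= v w ^+ 4.
  by apply: le_trans rN0; rewrite ler_wiXn2l ?absval_ge0 ?ltW// leq_maxl.
set T := q * lambert_poly w N - a^-1 *: P.
have Te y : v y = v x -> v T.[y] <= v w ^+ 4.
  move=> yx; have y1 : Mp v y by rewrite /Mp/= yx.
  have qy : v q.[y] <= 1 by rewrite absval_horner_le1// ltW.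
  have qy0 : q.[y] != 0.
    by apply: contraNneq (nr y y1) => qy0; rewrite QE rootE hornerZ qy0 mulr0.
  have -> : T.[y] = q.[y] * (lambertW (w * y : valued v) - P.[y] / Q.[y])
      - q.[y] * (lambertW (w * y : valued v) - (lambert_poly w N).[y]).
    rewrite -mulrBr opprB addrC subrKA.
    rewrite /T !hornerE mulrBr QE hornerZ invfM; congr (_ - _).
    by rewrite [RHS]mulrCA [a^-1 / _]mulrC mulVKf// mulrC.
  apply: absvalB_le; rewrite absvalM -[leRHS]mul1r ler_pM ?absval_ge0//.
    exact: hm.
  by apply: le_trans rN; rewrite -yx; apply: approx.
have := cauchy_estimate n (prime_gt0 p_prime) (absval_natp_lt1 p_prime vp wE)
  (exprn_ge0 4 (ltW w0)) Te.
rewrite rn exprSr ler_pM2r// leNgt => /negP; apply.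
have -> : T`_n = (q * lambert_poly w N)`_n.
  rewrite coefB coefZ [P`_n]nth_default ?mulr0 ?subr0//.
  apply/leqW/ltnW; apply: leq_ltn_trans (ltn_expl k (prime_gt1 p_prime)).
  exact: leq_addr.
by apply: lambert_poly_mul_coef => //; rewrite ?leq_addl ?leq_maxr.
Qed.
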